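(* Let $(c_n(\lambda))_{n\ge 0}$ be the sequence of polynomials in $\lambda$ defined by $c_0(\lambda)=1$ and, for $n\ge 1$, $$c_{n}(\lambda) = (3-\lambda)c_{n-1}(\lambda) - \sum_{i=2}^{n}(-1)^{i}(2^{i+1}-1)c_{n-i}(\lambda).$$ Then for all $n\ge 0$, $$c_{n}(\lambda) = \sum_{t=0}^{n}\left(\sum_{\ell=0}^{t}\binom{t}{\ell}(-1)^{t}2^{t-\ell}3^{n+2\ell-3t-2}\left[2\binom{\ell}{n+2\ell-3t-2}+9\binom{\ell+1}{n+2\ell-3t}\right]\right) \lambda^{t}.$$
   Context: Empty sums are $0$. Binomial coefficients $\binom{a}{b}$ with $a\ge 0$ are $0$ when $b<0$ or $b>a$. Powers of $3$ with negative exponents are rational numbers. *)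

(* Defs.v *)
From HB Require Import structures.
From mathcomp Require Import all_boot all_order all_algebra.
Set Implicit Arguments. Unset Strict Implicit. Unset Printing Implicit Defensive.

Definition binz (a : nat) (b : int) : nat :=
  if b is Posz k then 'C(a, k) else 0.

(* Main.v *)
(* With a_i = (-1)^i (2^(i+1) - 1), sum_i a_i x^i = 1/q for
   q = (1 + x)(1 + 2x) = 1 + 3x + 2x^2, so the recurrence says
   (1/q + lambda x) sum_n c_n x^n = 1, that is,
   sum_n c_n x^n = sum_t (-lambda)^t x^t q^(t+1).
   The formula follows by expanding q^t = ((1 + 3x) + 2x^2)^t binomially. *)
Require Import Defs.
From HB Require Import structures.
From mathcomp Require Import all_boot all_order all_algebra.
From mathcomp Require Import ring lra zify.
Import Order.TTheory GRing.Theory Num.Theory.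
Local Open Scope ring_scope.

Definition a_ (i : nat) : rat := (-1) ^+ i * (2 ^+ (i + 1) - 1).

Definition q : {poly rat} := 1 + 3%:P * 'X + 2%:P * 'X^2.

(** Truncating the series 1/[q] keeps everything polynomial, and up to degree [m] the truncation is
    invisible. From degree 2 on the product vanishes because a_i + 3 a_(i-1) + 2 a_(i-2) = 0, as the
    roots -1 and -2 of y^2 + 3y + 2 dictate. *)
Lemma coef_truncated_a_q (m i : nat) : (i <= m)%N ->
  ((\poly_(j < m.+1) a_ j) * q)`_i = (i == 0%N)%:R.
Proof.
move=> le_im; rewrite /q !mulrDr mulr1 (mulrA _ 3%:P) (mulrA _ 2%:P).
rewrite !coefD coefMX coefMXn !coefMC.
rewrite !coef_poly ltnS le_im.
case: i le_im => [|[|i]] le_im; rewrite /a_ /=.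
- by rewrite addr0 expr1; ring.
- by ring.
- have lt1 : (i.+1 < m.+1)%N by lia.
  have lt2 : (i < m.+1)%N by lia.
  by rewrite !subSS subn0 lt1 lt2 !addn1 !exprS; ring.
Qed.

(** Convolution with [a_] undoes multiplication by [q]: the degree [m] coefficient sees only degrees
    up to [m], where the truncated inverse is exact. *)
Lemma sum_a_coef_qM (p : {poly rat}) (m : nat) :
  \sum_(i < m.+1) a_ i * (q * p)`_(m - i) = p`_m.
Proof.
pose A : {poly rat} := \poly_(j < m.+1) a_ j.
transitivity (A * (q * p))`_m.
  by rewrite coefM; apply: eq_bigr => i _; rewrite coef_poly ltn_ord.
rewrite mulrA coefM big_ord_recl coef_truncated_a_q // subn0 mul1r.
rewrite big1 ?addr0 // => i _.
by rewrite coef_truncated_a_q ?mul0r //=; exact: ltn_ord.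
Qed.

(** Strong induction on [n], with [t] general because the factor lambda relates [t] to [t - 1]. Here
    ['X] stands for lambda in [c n] but for x on the right-hand side. *)
Lemma coef_recurrence_solution (c : nat -> {poly rat})
  (hc0 : c 0%N = 1)
  (hc : forall n : nat, (1 <= n)%N ->
     c n = (3%:P - 'X) * c (n - 1)%N
           - \sum_(2 <= i < n.+1) a_ i *: c (n - i)%N)
  (n t : nat) :
  (c n)`_t = (-1) ^+ t * ('X^t * q ^+ t.+1)`_n.
Proof.
elim/ltn_ind: n t => -[|n] IH t.
  rewrite hc0 coef1 coefXnM; case: t => [|t] /=; last by rewrite mulr0.
  by rewrite expr1 /q !coefD coefMX coefMXn coef1 /= !addr0 mulr1.
rewrite hc // subSS subn0 coefB mulrBl coefB coefCM coefXM coef_sum.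
have -> : \sum_(2 <= i < n.+2) (a_ i *: c (n.+1 - i)%N)`_t =
    (-1) ^+ t *
    \sum_(2 <= i < n.+2) a_ i * ('X^t * q ^+ t.+1)`_(n.+1 - i).
  rewrite mulr_sumr; apply: eq_big_nat => i /andP[i2 _].
  have lt_in : (n.+1 - i < n.+1)%N by rewrite ltn_subrL (ltnW i2).
  by rewrite coefZ (IH _ lt_in t) mulrCA.
(* With p = x^t q^t this is a recurrence for the coefficients of x^t q^(t+1). Isolating i = 0 and i
   = 1, where a_0 = 1 and a_1 = -3, gives that of [c] with the coefficient of x^t q^t in place of
   the lambda term. *)
have := sum_a_coef_qM ('X^t * q ^+ t) n.+1.
rewrite mulrCA -exprS -(big_mkord xpredT
  (fun i => a_ i * ('X^t * q ^+ t.+1)`_(n.+1 - i))).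
rewrite big_ltn // big_ltn // subn0 subSS subn0.
set S := \sum_(2 <= i < _) _ => E.
have a0 : a_ 0 = 1 by rewrite /a_; ring.
have a1 : a_ 1 = -3 by rewrite /a_; ring.
rewrite a0 a1 mul1r in E.
have -> : ('X^t * q ^+ t.+1)`_n.+1 =
   ('X^t * q ^+ t)`_n.+1 + 3 * ('X^t * q ^+ t.+1)`_n - S by lra.
(* For t = 0 the extra term is a coefficient of 1 in positive degree, hence 0. Otherwise cancelling
   one x turns it into the induction hypothesis at [t - 1], the sign coming from -lambda. *)
rewrite (IH n (ltnSn n)); case: t {E} @S => [|t] S; clearbody S.
  by rewrite !mul1r coef1 /=; ring.
rewrite (IH n (ltnSn n)) /=.
have -> : ('X^(t.+1) * q ^+ t.+1)`_n.+1 = ('X^t * q ^+ t.+1)`_n.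
  by rewrite (exprS 'X t) -mulrA coefXM.
by rewrite [(-1) ^+ t.+1]exprS; ring.
Qed.

Lemma coef_Xn_linear_exp (k l n : nat) :
  ('X^k * (1 + 3%:P * 'X) ^+ l : {poly rat})`_n =
  3 ^ (n%:Z - k%:Z) * (binz l (n%:Z - k%:Z))%:R.
Proof.
rewrite coefXnM; case: ltnP => [lt_nk|le_kn].
  (* At a negative index [binz] is 0, so the negative power of 3 is harmless. *)
  have [m ->] : exists m, n%:Z - k%:Z = Negz m by exists (k - n).-1; lia.
  by rewrite mulr0.
rewrite subzn //= exprDn; move: (n - k)%N => m.
rewrite (eq_bigr (fun i : 'I_l.+1 => (3 ^+ i *+ 'C(l, i)) *: 'X^i)); last first.
  move=> i _; rewrite expr1n mul1r exprMn -rmorphXn /= mul_polyC.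
  by rewrite scalerMnl.
rewrite -(poly_def l.+1 (fun i => 3 ^+ i *+ 'C(l, i))) coef_poly ltnS.
case: leqP => [_|lt_lm]; first by rewrite -exprnP mulr_natr.
by rewrite bin_small ?mulr0.
Qed.

(** Only q^t is expanded, with [l] counting the factors 1 + 3x. The remaining factor q = (1 + 3x) +
    2x^2 produces the two binomials in the bracket. *)
Lemma coef_Xn_qn (t n : nat) :
  ('X^t * q ^+ t.+1)`_n =
  \sum_(0 <= l < t.+1)
     'C(t, l)%:R * 2 ^+ (t - l)
     * 3 ^ (n%:Z + 2 * l%:Z - 3 * t%:Z - 2)
     * (2 * (binz l (n%:Z + 2 * l%:Z - 3 * t%:Z - 2))%:R
        + 9 * (binz (l + 1) (n%:Z + 2 * l%:Z - 3 * t%:Z))%:R).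
Proof.
rewrite exprSr mulrA {1}/q addrC exprDn mulr_sumr mulr_suml coef_sum big_mkord.
apply: eq_bigr => l _.
have le_lt : (l <= t)%N by rewrite -ltnS.
pose L : {poly rat} := 1 + 3%:P * 'X.
have -> : 'X^t * ((2%:P * 'X^2) ^+ (t - l) * L ^+ l *+ 'C(t, l)) * q =
    ('C(t, l)%:R * 2 ^+ (t - l))%:P *
    ('X^(t + 2 * (t - l)) * L ^+ l.+1
     + 2%:P * ('X^(t + 2 * (t - l) + 2) * L ^+ l)).
  rewrite /q -/L -mulr_natr exprMn -exprM polyCM rmorphXn /= !polyC_natr !exprD.
  by rewrite (exprS L l); ring.
rewrite coefCM coefD coefCM !coef_Xn_linear_exp addn1.
have -> : n%:Z - (t + 2 * (t - l))%:Z = n%:Z + 2 * l%:Z - 3 * t%:Z by lia.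
have -> : n%:Z - (t + 2 * (t - l) + 2)%:Z = n%:Z + 2 * l%:Z - 3 * t%:Z - 2.
  by lia.
move: (n%:Z + _ - _) => m.
(* The two terms carry 3^m and 3^(m-2); taking out the latter leaves the 9. *)
have -> : 3 ^ m = 9 * 3 ^ (m - 2) :> rat.
  by rewrite -[X in 3 ^ X = _](subrK 2) expfzDr // mulrC.
by ring.
Qed.

Theorem theorem13 (c : nat -> {poly rat})
  (hc0 : c 0%N = 1)
  (hc : forall n : nat, (1 <= n)%N ->
     c n = (3%:P - 'X) * c (n - 1)%N
           - \sum_(2 <= i < n.+1) ((-1) ^+ i * (2 ^+ (i + 1) - 1)) *: c (n - i)%N)
  (n : nat) :
  c n = \sum_(0 <= t < n.+1)
          (\sum_(0 <= l < t.+1)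
             'C(t, l)%:R * (-1) ^+ t * 2 ^+ (t - l)
             * 3 ^ (n%:Z + 2 * l%:Z - 3 * t%:Z - 2)
             * (2 * (binz l (n%:Z + 2 * l%:Z - 3 * t%:Z - 2))%:R
                + 9 * (binz (l + 1) (n%:Z + 2 * l%:Z - 3 * t%:Z))%:R))
          *: 'X^t.
Proof.
under eq_bigr do under eq_bigr do rewrite -mulrA.
rewrite big_mkord.
rewrite -(poly_def n.+1 (fun t => \sum_(0 <= l < t.+1)
             ('C(t, l)%:R * (-1) ^+ t * 2 ^+ (t - l)
             * (3 ^ (n%:Z + 2 * l%:Z - 3 * t%:Z - 2)
             * (2 * (binz l (n%:Z + 2 * l%:Z - 3 * t%:Z - 2))%:R
                + 9 * (binz (l + 1) (n%:Z + 2 * l%:Z - 3 * t%:Z))%:R))))).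
apply/polyP => t.
rewrite (coef_recurrence_solution _ hc0 hc) coef_poly ltnS.
(* For t > n the factor x^t kills the coefficient in degree n, matching the end of the sum. *)
case: leqP => [_|lt_nt]; last by rewrite coefXnM lt_nt mulr0.
rewrite coef_Xn_qn mulr_sumr; apply: eq_bigr => l _; ring.
Qed.
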